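(* Let $d\ge 1$ be an integer and let $p\in\{1,\ldots,2^{d-1}\}$. For every $\varphi\in\ell^2(\mathbb{Z}^d)$, $$ \|\varphi\|_{\ell^\infty(\mathbb{Z}^d)}\leq \mu_{p,d}\,\|\nabla_D\varphi\|^{p/2^d}_{\ell^2(\mathbb{Z}^d)}\,\|\varphi\|^{1-p/2^d}_{\ell^2(\mathbb{Z}^d)}, $$ where $$ \mu_{p,d}:=\left(\frac{\kappa_{p,d}}{d^{p/2}}\right)^{1/2^d},\qquad \kappa_{p,d}:=2^{\,d\cdot 2^{d-1}-p}. $$
   Context: A sequence $\varphi=\{\varphi(\zeta)\}_{\zeta\in\mathbb{Z}^d}$ of complex numbers belongs to $\ell^2(\mathbb{Z}^d)$ iff the norm $\|\varphi\|_{\ell^2(\mathbb{Z}^d)}:=\big(\sum_{\zeta\in\mathbb{Z}^d}|\varphi(\zeta)|^2\big)^{1/2}$ is finite, and $\|\varphi\|_{\ell^\infty(\mathbb{Z}^d)}:=\sup_{\zeta\in\mathbb{Z}^d}|\varphi(\zeta)|$. For $i\in\{1,\ldots,d\}$ the partial difference operator $D_i$ is $(D_i\varphi)(\zeta):=\varphi(\zeta_1,\ldots,\zeta_i+1,\ldots,\zeta_d)-\varphi(\zeta_1,\ldots,\zeta_d)$. The discrete gradient is $\nabla_D\varphi(\zeta):=(D_1\varphi(\zeta),\ldots,D_d\varphi(\zeta))$, with norm given by $\|\nabla_D\varphi\|^2_{\ell^2(\mathbb{Z}^d)}=\|D_1\varphi\|^2_{\ell^2(\mathbb{Z}^d)}+\cdots+\|D_d\varphi\|^2_{\ell^2(\mathbb{Z}^d)}$.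 *)

(* Defs.v *)
From mathcomp Require Import all_boot all_order all_algebra.
From mathcomp Require Import all_classical all_reals all_analysis.
From mathcomp.real_closed Require Export complex.

Set Implicit Arguments.
Unset Strict Implicit.
Unset Printing Implicit Defensive.

Import Order.TTheory GRing.Theory Num.Theory.

Local Open Scope classical_set_scope.
Local Open Scope ring_scope.
Local Open Scope ereal_scope.
Local Open Scope complex_scope.

Definition lattice (d : nat) := 'rV[int]_d.

(* Norms take values in [\bar R], so that the norm of a sequence outside
   l^2 (or of an unbounded one) is +oo rather than a junk real number.
   The modulus is [normc : R[i] -> R], since [`|z|] lives in [R[i]]. *)
Definition l2norm (R : realType) (d : nat) (phi : lattice d -> R[i]) : \bar R :=
  (\esum_(z in [set: lattice d]) ((Normc.normc (phi z) ^+ 2)%R)%:E) `^ (2^-1)%R.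

Definition l2 (R : realType) (d : nat) : set (lattice d -> R[i]) :=
  [set phi | l2norm phi < +oo].

Definition linfnorm (R : realType) (d : nat) (phi : lattice d -> R[i]) : \bar R :=
  ereal_sup [set (Normc.normc (phi z))%:E | z in [set: lattice d]].

Definition diffop (R : realType) (d : nat) (i : 'I_d) (phi : lattice d -> R[i])
  : lattice d -> R[i] :=
  fun z => (phi (z + delta_mx 0 i) - phi z)%R.

Definition dgrad (R : realType) (d : nat) (phi : lattice d -> R[i])
  : lattice d -> 'rV[R[i]]_d :=
  fun z => (\row_(i < d) diffop i phi z)%R.

Definition l2norm_vec (R : realType) (d : nat) (v : lattice d -> 'rV[R[i]]_d)
  : \bar R :=
  (\sum_(i < d) (l2norm (fun z => v z ord0 i)) ^+ 2) `^ (2^-1)%R.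

Definition kappa (R : realType) (p d : nat) : R :=
  (2 `^ (d%:R * 2 ^+ d.-1 - p%:R))%R.

Definition mu (R : realType) (p d : nat) : R :=
  ((kappa R p d / d%:R `^ (p%:R / 2)) `^ (1 / 2 ^+ d))%R.

(* Main.v *)
Require Import Defs.
From mathcomp Require Import all_boot all_order all_algebra.
From mathcomp Require Import all_classical all_reals all_analysis.
From mathcomp Require Import ring lra.

Set Implicit Arguments.
Unset Strict Implicit.
Unset Printing Implicit Defensive.

Import Order.TTheory GRing.Theory Num.Theory.

Local Open Scope classical_set_scope.
Local Open Scope ring_scope.
Local Open Scope ereal_scope.
Local Open Scope complex_scope.

(** The inequality is Agmon's inequality in dimension one, applied along
    the [d] coordinate lines through a point and then interpolated with a
    trivial bound.

    On a line, [f k] and [g k] stand for the moduli of [phi] and of its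
    difference at the [k]-th point, so that [|f (k + 1) - f k| <= g k]. Since
    [f] is square summable, [f 0 ^+ 2] is at most the variation of [f ^+ 2]
    on the right half-line, and also at most its variation on the left one;
    averaging the two gives
    [2 f(0)^2 <= \sum_k g(k) (f(k) + f(k + 1)) <= 2 ||g|| ||f||]. It is the
    use of both half-lines that yields the constant [1] in
    [f(0)^2 <= ||g|| ||f||] ([agmon_int]).

    The sums over a line are bounded by the sums over the whole lattice, so
    [|phi(z)|^4 <= ||D_i phi||^2 ||phi||^2] for every [i]. Adding these [d]
    inequalities produces the gradient:
    [d |phi(z)|^4 <= ||grad phi||^2 ||phi||^2] ([normc_pow4_le_grad]).

    Put [s = p / 2^d], which is at most [1/2] because [p <= 2^(d-1)]. Writing
    [|phi(z)| = (|phi(z)|^4)^(s/2) (|phi(z)|^2)^(1/2-s)] and bounding the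
    second factor by [|phi(z)| <= ||phi||] gives
    [|phi(z)| <= d^(-s/2) ||grad phi||^s ||phi||^(1-s)] ([interpolate_powR]).
    The stated constant [mu] is [d^(-s/2)] times the [2^d]-th root of
    [kappa], and [kappa >= 1] because its exponent is nonnegative. *)

(** * Agmon's inequality on the integers *)

(** The index [n] is the centre of the window [0 .. n + n]: the value there is
    reached from both ends, and the two telescoping sums use disjoint
    increments. *)
Lemma double_le_sum_variation (R : realDomainType) (b c : nat -> R) (n : nat) :
  (forall j, `|b j.+1 - b j| <= c j)%R ->
  (b n *+ 2 <= b 0%N + b (n + n)%N + \sum_(0 <= j < n + n) c j)%R.
Proof.
move=> bc.
have left : (b n - b 0%N <= \sum_(0 <= j < n) c j)%R.
  rewrite -telescope_sumr //; apply: ler_sum => j _.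
  by have := bc j; rewrite ler_norml => /andP[].
have right : (b n - b (n + n)%N <= \sum_(n <= j < n + n) c j)%R.
  rewrite -opprB -telescope_sumr ?leq_addr // -sumrN; apply: ler_sum => j _.
  by have := bc j; rewrite ler_norml => /andP[+ _]; rewrite lerNl.
rewrite (big_cat_nat (leq0n n) (leq_addr n n)) /= mulr2n.
lra.
Qed.

(** Optimising the weight [t] turns a weighted arithmetic-geometric bound into
    its product form. The optimal [t] is [sqrt (F / G)], but [t = a / G] already
    gives the sharp conclusion and needs no root. It lets the Cauchy-Schwarz
    inequality be used one term at a time. *)
Lemma sqr_le_mul_of_weighted (R : realFieldType) (a G F : R) :
  (0 <= a -> 0 <= G -> 0 <= F ->
   (forall t, 0 < t -> a *+ 2 <= t * G + F / t) -> a ^+ 2 <= G * F)%R.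
Proof.
move=> a0 G0 F0 H.
have [->|an0] := eqVneq a 0%R; first by rewrite expr0n /= mulr_ge0.
have {an0}a0 : (0 < a)%R by rewrite lt_neqAle eq_sym an0.
have [G_eq|Gn0] := eqVneq G 0%R.
  (* With G = 0 this t would give 2 a <= F / t = a F / (F + 1) < a. *)
  have t0 : (0 < (F + 1) / a)%R by rewrite divr_gt0 // ltr_wpDl.
  have := H _ t0; rewrite G_eq mulr0 add0r invf_div mulrA ler_pdivlMr; last lra.
  by rewrite mulr2n => ?; nra.
have {Gn0}G0 : (0 < G)%R by rewrite lt_neqAle eq_sym Gn0.
have := H _ (divr_gt0 a0 G0).
rewrite divfK ?gt_eqF // mulr2n lerD2l invf_div mulrA ler_pdivlMr // -expr2.
by rewrite (mulrC F G).
Qed.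

(** Square summability is phrased through the partial sums along injective
    enumerations, which covers both the windows [-n .. n] and the two
    half-lines. The boundary terms [f (- n) ^+ 2 + f n ^+ 2] are removed by
    averaging over [n]: their sum over all [n] is at most [F + F], so they
    cannot all exceed the same positive number. *)
Lemma agmon_int (R : realType) (f g : int -> R) (F G : R) :
  (forall k, 0 <= f k)%R ->
  (forall k, `|f (k + 1) - f k| <= g k)%R ->
  (forall h : nat -> int, injective h ->
     forall n, \sum_(0 <= j < n) f (h j) ^+ 2 <= F)%R ->
  (forall h : nat -> int, injective h ->
     forall n, \sum_(0 <= j < n) g (h j) ^+ 2 <= G)%R ->
  (f 0 ^+ 4 <= G * F)%R.
Proof.
move=> f0 fg sumF sumG.
have Posz_inj : injective Posz by move=> x y [].
have F0 : (0 <= F)%R by have := sumF _ Posz_inj 0%N; rewrite big_nil.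
have G0 : (0 <= G)%R by have := sumG _ Posz_inj 0%N; rewrite big_nil.
rewrite (_ : f 0 ^+ 4 = (f 0 ^+ 2) ^+ 2)%R; last by rewrite -exprM.
apply: sqr_le_mul_of_weighted => // [|t t0]; first exact: sqr_ge0.
have window n : (f 0 ^+ 2 *+ 2 - (t * G + F / t)
                   <= f (- n%:Z) ^+ 2 + f n%:Z ^+ 2)%R.
  pose u j := f (j%:Z - n%:Z)%R; pose v j := g (j%:Z - n%:Z)%R.
  have u_succ j : u j.+1 = f (j%:Z - n%:Z + 1)%R.
    by rewrite /u; congr f; rewrite -addn1 PoszD addrAC.
  have uv j : (`|u j.+1 - u j| <= v j)%R by rewrite u_succ; exact: fg.
  have u0 j : (0 <= u j)%R by exact: f0.
  have := @double_le_sum_variation R (fun j => u j ^+ 2)%R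
    (fun j => v j * (u j + u j.+1))%R n.
  move=> /(_ _)/wrap[j|].
    rewrite subr_sqr normrM [X in (_ * X)%R]ger0_norm ?addr_ge0 //.
    by rewrite [X in (_ * X)%R]addrC ler_wpM2r ?addr_ge0.
  rewrite /u subrr sub0r PoszD addrK -/u.
  suff : (\sum_(0 <= j < n + n) v j * (u j + u j.+1) <= t * G + F / t)%R.
    by rewrite mulr2n; lra.
  (* v (u + u') <= t v^2 + (u^2 + u'^2) / (2 t), once for each of u and u'. *)
  apply: (@le_trans _ _ (\sum_(0 <= j < n + n)
      (t * v j ^+ 2 + (u j ^+ 2 / (t *+ 2) + u j.+1 ^+ 2 / (t *+ 2))))%R).
    apply: ler_sum => j _.
    rewrite -subr_ge0.
    rewrite [X in (0 <= X)%R](_ : _ =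
      ((t * v j - u j) ^+ 2 + (t * v j - u j.+1) ^+ 2) / (t *+ 2))%R.
      apply: divr_ge0; last by rewrite mulrn_wge0 // ltW.
      by apply: addr_ge0; exact: sqr_ge0.
    by rewrite mulr2n; field; lra.
  rewrite !big_split /= -mulr_sumr -!mulr_suml.
  have shift_inj m : injective (fun j : nat => j%:Z + m)%R.
    by move=> x y /addIr[].
  have vG := sumG _ (shift_inj (- n%:Z)%R) (n + n)%N.
  have uF := sumF _ (shift_inj (- n%:Z)%R) (n + n)%N.
  have uF' := sumF _ (shift_inj (- n%:Z + 1)%R) (n + n)%N.
  rewrite lerD //; first by rewrite ler_wpM2l // ltW.
  rewrite -mulrDl (_ : F / t = (F + F) / (t *+ 2))%R; last first.
    by rewrite mulr2n; field; lra.
  rewrite ler_pM2r; last by rewrite invr_gt0 mulrn_wgt0.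
  apply: lerD => //.
  by under eq_bigr do rewrite u_succ -addrA.
have summed n : ((f 0 ^+ 2 *+ 2 - (t * G + F / t)) *+ n <= F + F)%R.
  rewrite -[n in (_ *+ n)%R]subn0 -sumr_const_nat.
  apply: le_trans (ler_sum _ (fun j _ => window j)) _.
  rewrite big_split /= lerD //; last exact: sumF.
  by apply: (sumF (fun j => - j%:Z)%R) => x y /oppr_inj[].
rewrite -subr_le0 leNgt; apply/negP => pos.
have := archi_boundP (divr_ge0 (addr_ge0 F0 F0) (ltW pos)).
by rewrite ltr_pdivrMr // mulrC mulr_natr ltNge summed.
Qed.

(** * Square sums over the lattice *)

Lemma sum_inj_le_esum (R : realType) (T : choiceType) (a : T -> R)
    (h : nat -> T) (n : nat) :
  (forall z, 0 <= a z)%R -> injective h ->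
  (\sum_(0 <= j < n) a (h j))%:E <= \esum_(z in [set: T]) (a z)%:E.
Proof.
move=> a0 h_inj; rewrite -sumEFin.
apply: (@le_trans _ _ (\sum_(0 <= j <oo) (a (h j))%:E)).
  by apply: nneseries_lim_ge => j _ _; rewrite lee_fin.
rewrite nneseries_esumT; last by move=> j; rewrite lee_fin.
rewrite -(@esum_image _ _ _ setT h (fun z => (a z)%:E)); last first.
  by move=> x y _ _; exact: h_inj.
rewrite esum_mkcond; apply: le_esum => z _.
by case: ifP => // _; rewrite lee_fin.
Qed.

(** The square of [l2norm]; it keeps the sum free of the power [2^-1]. *)
Definition l2mass (R : realType) (d : nat) (phi : lattice d -> R[i]) : \bar R :=
  \esum_(z in [set: lattice d]) ((Normc.normc (phi z) ^+ 2)%R)%:E.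

Lemma normc_ge0 (R : realType) (x : R[i]) : (0 <= Normc.normc x)%R.
Proof. by case: x => x y; exact: sqrtr_ge0. Qed.

Lemma normcB (R : realType) (x y : R[i]) :
  (Normc.normc (x - y) <= Normc.normc x + Normc.normc y)%R.
Proof. by rewrite -(normcN y); exact: le_normcD. Qed.

Lemma normc_dist (R : realType) (x y : R[i]) :
  (`|Normc.normc x - Normc.normc y| <= Normc.normc (x - y))%R.
Proof.
rewrite ler_norml; apply/andP; split.
  rewrite lerBrDr addrC lerBlDr.
  by have := normcB x (x - y)%R; rewrite subKr addrC.
by rewrite lerBlDr; have := le_normcD (x - y)%R y; rewrite subrK.
Qed.

Lemma l2mass_ge0 (R : realType) (d : nat) (phi : lattice d -> R[i]) :
  0 <= l2mass phi.
Proof. by apply: esum_ge0 => z _; rewrite lee_fin sqr_ge0. Qed.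

(** By [|x - y|^2 <= 2 |x|^2 + 2 |y|^2] and the translation invariance of the
    sum over the lattice. *)
Lemma l2mass_diffop_lty (R : realType) (d : nat) (phi : lattice d -> R[i])
    (i : 'I_d) :
  l2mass phi < +oo -> l2mass (diffop i phi) < +oo.
Proof.
move=> phi_fin.
pose w z := ((Normc.normc (phi z) ^+ 2)%R)%:E.
have shift : \esum_(z in [set: lattice d]) w (z + delta_mx 0 i)%R = l2mass phi.
  rewrite /l2mass.
  rewrite -(@reindex_esum _ _ _ setT setT (fun z => z + delta_mx 0 i)%R w) //.
  split=> // [x y _ _ /addIr //|y _].
  by exists (y - delta_mx 0 i)%R; rewrite ?subrK.
have w0 z : 0 <= w z by rewrite lee_fin sqr_ge0.
apply: (@le_lt_trans _ _ (\esum_(z in [set: lattice d])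
   ((w (z + delta_mx 0 i)%R + w z) + (w (z + delta_mx 0 i)%R + w z)))).
  apply: le_esum => z _; rewrite /w -!EFinD lee_fin /diffop.
  have := normcB (phi (z + delta_mx 0 i)%R) (phi z).
  move: (normc_ge0 (phi (z + delta_mx 0 i) - phi z)%R).
  move: (Normc.normc _) (Normc.normc (phi (z + _)%R)) (Normc.normc (phi z)).
  move=> x y y' x0 xy.
  have := sqr_ge0 (y - y')%R; have : (x ^+ 2 <= (y + y') ^+ 2)%R.
    by rewrite lerXn2r ?nnegrE // (le_trans x0).
  by rewrite sqrrD sqrrB; lra.
rewrite !esumD //; do ?by move=> *; rewrite ?adde_ge0.
by rewrite shift !lte_add_pinfty.
Qed.

Lemma sqr_normc_le_l2mass (R : realType) (d : nat) (phi : lattice d -> R[i])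
    (z : lattice d) :
  l2mass phi < +oo -> (Normc.normc (phi z) ^+ 2 <= fine (l2mass phi))%R.
Proof.
move=> phi_fin; rewrite -lee_fin fineK ?ge0_fin_numE ?l2mass_ge0 //.
apply: esum_ge; exists [set z]; first by split.
by rewrite fsbig_set1.
Qed.

(** * The pointwise bound by the gradient *)

(** [agmon_int] on the line through [z] in direction [i], whose square sums
    are at most those over the lattice. *)
Lemma normc_pow4_le_axis (R : realType) (d : nat) (phi : lattice d -> R[i])
    (i : 'I_d) (z : lattice d) :
  l2mass phi < +oo ->
  (Normc.normc (phi z) ^+ 4
     <= fine (l2mass (diffop i phi)) * fine (l2mass phi))%R.
Proof.
move=> phi_fin; have dphi_fin := l2mass_diffop_lty i phi_fin.
pose line (k : int) : lattice d := (z + (delta_mx 0 i *~ k))%R.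
have line_inj : injective line.
  move=> k l /addrI /(congr1 (fun v : 'rV[int]_d => v 0%R i)).
  rewrite -!scaler_int !mxE !eqxx /= !mulr1 => e.
  by move: e; rewrite !intz.
have sums (psi : lattice d -> R[i]) : l2mass psi < +oo ->
    forall h : nat -> int, injective h ->
    forall n, (\sum_(0 <= j < n) Normc.normc (psi (line (h j))) ^+ 2
                 <= fine (l2mass psi))%R.
  move=> psi_fin h h_inj n.
  rewrite -lee_fin fineK; last by rewrite ge0_fin_numE ?l2mass_ge0.
  apply: (@sum_inj_le_esum _ _
    (fun z => Normc.normc (psi z) ^+ 2)%R (line \o h)).
    by move=> ?; exact: sqr_ge0.
  exact: inj_comp.
have -> : z = line 0%R by rewrite /line mulr0z addr0.
apply: (@agmon_int R (fun k => Normc.normc (phi (line k)))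
  (fun k => Normc.normc (diffop i phi (line k)))) => [k|k||].
- exact: normc_ge0.
- by rewrite /diffop /line mulrzDr mulr1z addrA normc_dist.
- exact: sums.
- exact: sums.
Qed.

Lemma normc_pow4_le_grad (R : realType) (d : nat) (phi : lattice d -> R[i])
    (z : lattice d) :
  l2mass phi < +oo ->
  (d%:R * Normc.normc (phi z) ^+ 4
     <= (\sum_(i < d) fine (l2mass (diffop i phi))) * fine (l2mass phi))%R.
Proof.
move=> phi_fin; rewrite mulr_suml mulr_natl.
rewrite -[X in (_ *+ X)%R]card_ord -sumr_const.
by apply: ler_sum => i _; exact: normc_pow4_le_axis.
Qed.

Lemma l2normE (R : realType) (d : nat) (phi : lattice d -> R[i]) :
  l2mass phi < +oo ->
  l2norm phi = ((fine (l2mass phi) `^ 2^-1)%R)%:E.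
Proof.
by move=> ?; rewrite -poweR_EFin fineK // ge0_fin_numE ?l2mass_ge0.
Qed.

Lemma l2norm_dgradE (R : realType) (d : nat) (phi : lattice d -> R[i]) :
  l2mass phi < +oo ->
  l2norm_vec (dgrad phi)
    = (((\sum_(i < d) fine (l2mass (diffop i phi))) `^ 2^-1)%R)%:E.
Proof.
move=> phi_fin; rewrite /l2norm_vec -poweR_EFin -sumEFin; congr (_ `^ _).
apply: eq_bigr => i _.
have -> : (fun z => dgrad phi z ord0 i) = diffop i phi.
  by apply/funext => z; rewrite mxE.
rewrite (l2normE (l2mass_diffop_lty i phi_fin)) -EFin_expe; congr (_%:E).
rewrite -powR_mulrn ?powR_ge0 // -powRrM mulVf // powRr1 //.
by rewrite fine_ge0 ?l2mass_ge0.
Qed.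

(** * Interpolation *)

(** The range of [s] makes both exponents in
    [a = (a ^+ 4) `^ (s / 2) * (a ^+ 2) `^ (2^-1 - s)] nonnegative, so that
    each factor can be bounded monotonically. *)
Lemma interpolate_powR (R : realType) (D a G F s : R) :
  (0 < D -> 0 <= a -> 0 <= G -> 0 <= F -> 0 <= s <= 2^-1 ->
   D * a ^+ 4 <= G * F -> a ^+ 2 <= F ->
   a <= D `^ (- (s / 2)) * (G `^ 2^-1) `^ s * (F `^ 2^-1) `^ (1 - s))%R.
Proof.
move=> D0 a0 G0 F0 /andP[s0 s1] a4 a2.
have [->|an0] := eqVneq a 0%R; first by rewrite !mulr_ge0 ?powR_ge0.
have {an0}a0 : (0 < a)%R by rewrite lt_neqAle eq_sym an0.
have {}F0 : (0 < F)%R by apply: lt_le_trans a2; rewrite exprn_gt0.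
have -> : a = ((a ^+ 4) `^ (s / 2) * (a ^+ 2) `^ (2^-1 - s))%R.
  rewrite -!powR_mulrn ?(ltW a0) // -!powRrM.
  rewrite -powRD; last by rewrite (gt_eqF a0) implybT.
  by rewrite -[LHS]powRr1 ?(ltW a0) //; congr powR; field.
have -> : (D `^ (- (s / 2)) * (G `^ 2^-1) `^ s * (F `^ 2^-1) `^ (1 - s)
  = (G * F / D) `^ (s / 2) * F `^ (2^-1 - s))%R.
  rewrite !powRM ?invr_ge0 ?mulr_ge0 ?(ltW D0) ?(ltW F0) //.
  rewrite -(powR_inv1 (ltW D0)) -!powRrM mulN1r.
  have -> : (2^-1 * (1 - s) = s / 2 + (2^-1 - s))%R by field.
  rewrite powRD; last by rewrite (gt_eqF F0) implybT.
  by rewrite [(2^-1 * s)%R]mulrC; ring.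
apply: ler_pM; rewrite ?powR_ge0 //; apply: ge0_ler_powR;
  rewrite ?nnegrE ?exprn_ge0 ?divr_ge0 ?mulr_ge0 //
    ?(ltW D0) ?(ltW a0) ?(ltW F0) //.
- by rewrite ler_pdivlMr // mulrC.
- by rewrite subr_ge0.
Qed.

Theorem theorem2p4 (R : realType) (d p : nat) (hd : (1 <= d)%N)
    (hp : (1 <= p <= 2 ^ d.-1)%N) (phi : lattice d -> R[i])
    (hphi : l2 phi) :
  linfnorm phi <=
    (mu R p d)%:E
      * l2norm_vec (dgrad phi) `^ (p%:R / 2 ^+ d)%R
      * l2norm phi `^ (1 - p%:R / 2 ^+ d)%R.
Proof.
have phi_fin : l2mass phi < +oo by apply: lty_poweRy hphi; rewrite invr_eq0.
case: d => [|d] in hd hp phi hphi phi_fin * => //; case/andP: hp => p1 /= p2.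
rewrite l2normE // l2norm_dgradE // !poweR_EFin -!EFinM.
apply: ge_ereal_sup => _ [z _ <-]; rewrite lee_fin.
set s := (p%:R / 2 ^+ d.+1 : R)%R.
have s_half : (0 <= s <= 2^-1)%R.
  rewrite divr_ge0 ?exprn_ge0 //= /s exprS invfM mulrCA ler_piMr ?invr_ge0 //.
  by rewrite ler_pdivrMr ?exprn_gt0 // mul1r -natrX ler_nat.
have D0 : (0 < d.+1%:R :> R)%R by [].
apply: le_trans (interpolate_powR D0 _ _ _ s_half (normc_pow4_le_grad z phi_fin)
  (sqr_normc_le_l2mass z phi_fin)) _.
- exact: normc_ge0.
- by apply: sumr_ge0 => i _; rewrite fine_ge0 ?l2mass_ge0.
- by rewrite fine_ge0 ?l2mass_ge0.
rewrite -!mulrA ler_wpM2r ?mulr_ge0 ?powR_ge0 //.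
rewrite /mu powRM ?powR_ge0 ?invr_ge0 ?powR_ge0 // -powRN -powRrM.
rewrite [X in powR _ X](_ : _ = - (p%:R / 2 * (1 / 2 ^+ d.+1)))%R; last first.
  by rewrite /s; field.
rewrite -mulNr powRrM -[leLHS]mul1r ler_wpM2r ?powR_ge0 //.
have kappa1 : (1 <= kappa R p d.+1)%R.
  rewrite -(powRr0 2) /kappa /= ler_powR ?ler1n // subr_ge0.
  rewrite -natrX -natrM ler_nat (leq_trans p2) // leq_pmull //.
have e0 : (0 <= 1 / 2 ^+ d.+1 :> R)%R by rewrite divr_ge0 ?exprn_ge0.
have := ge0_ler_powR e0 (x := 1%R) (y := kappa R p d.+1); rewrite powR1.
by apply; rewrite ?nnegrE ?powR_ge0.
Qed.
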